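(* Let $\mathcal{GO}$ be a bivariate general overlap function having $1$ as neutral element, let $N$ be a fuzzy negation, and suppose that the function $I_{\mathcal{GO}}^{N}(x,y)=N(\mathcal{GO}(x,N(y)))$, $x,y\in[0,1]$, is crisp, i.e. $I_{\mathcal{GO}}^{N}(x,y)\in\{0,1\}$ for all $x,y\in[0,1]$. Then: (i) $I_{\mathcal{GO}}^{N}$ satisfies (EP) but does not satisfy (NP); (ii) $I_{\mathcal{GO}}^{N}$ satisfies (LOP) but does not satisfy (ROP); (iii) $I_{\mathcal{GO}}^{N}$ satisfies (IP); (iv) $I_{\mathcal{GO}}^{N}$ satisfies (IB); (v) $I_{\mathcal{GO}}^{N}$ satisfies (CP) with respect to $N$; (vi) $I_{\mathcal{GO}}^{N}$ satisfies (R-CP) with respect to $N$.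
   Context: A fuzzy negation is a map $N:[0,1]\to[0,1]$ with $N(0)=1$, $N(1)=0$ and $N(x)\le N(y)$ whenever $y\le x$. A bivariate general overlap function is a function $\mathcal{GO}:[0,1]^2\to[0,1]$ such that for all $x,y\in[0,1]$: (1) $\mathcal{GO}(x,y)=\mathcal{GO}(y,x)$; (2) if $xy=0$ then $\mathcal{GO}(x,y)=0$; (3) if $xy=1$ then $\mathcal{GO}(x,y)=1$; (4) $\mathcal{GO}$ is increasing (in the non-strict sense) in each variable; (5) $\mathcal{GO}$ is continuous. An element $a\in[0,1]$ is a neutral element of $\mathcal{GO}$ if $\mathcal{GO}(x,a)=x$ for all $x\in[0,1]$. For a function $I:[0,1]^2\to[0,1]$, the following properties are required for all $x,y,z\in[0,1]$: (NP) $I(1,y)=y$; (IP) $I(x,x)=1$; (EP) $I(x,I(y,z))=I(y,I(x,z))$; (IB) $I(x,I(x,y))=I(x,y)$; (LOP) $I(x,y)=1$ whenever $x\le y$; (ROP) $I(x,y)\ne 1$ whenever $x>y$; (CP) with respect to $N$: $I(x,y)=I(N(y),N(x))$; (R-CP) with respect to $N$: $I(x,N(y))=I(y,N(x))$. *)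

(* Defs.v *)
From HB Require Import structures.
From mathcomp Require Import all_boot all_order all_algebra.
From mathcomp Require Import interval_inference.
From mathcomp Require Import all_classical all_reals topology normedtype.

Set Implicit Arguments.
Unset Strict Implicit.
Unset Printing Implicit Defensive.

Import Order.TTheory GRing.Theory Num.Theory.
Import numFieldNormedType.Exports.

Local Open Scope classical_set_scope.
Local Open Scope ring_scope.

(** [{i01 R}] is the unit interval [0, 1] of [R]; its order is the one induced
    by [R].  It has no topology in the library: it gets the subspace one. *)
Definition i01_val (R : realType) (x : {i01 R}) : R := x%:num.

HB.instance Definition _ (R : realType) :=
  Topological.copy {i01 R} (initial_topology (@i01_val R)).

Section fuzzy_operators.
Context {R : realType}.
Local Notation U := {i01 R}.
Implicit Types (N : U -> U) (GO I : U -> U -> U).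

Record fuzzy_negation N : Prop := FuzzyNegation {
  fuzzy_negation0 : N 0%:i01 = 1%:i01 ;
  fuzzy_negation1 : N 1%:i01 = 0%:i01 ;
  fuzzy_negation_antitone : forall x y : U, y <= x -> N x <= N y }.

Record general_overlap GO : Prop := GeneralOverlap {
  general_overlapC : forall x y : U, GO x y = GO y x ;
  general_overlap0 : forall x y : U, x%:num * y%:num = 0 -> GO x y = 0%:i01 ;
  general_overlap1 : forall x y : U, x%:num * y%:num = 1 -> GO x y = 1%:i01 ;
  general_overlap_monol : forall x1 x2 y : U, x1 <= x2 -> GO x1 y <= GO x2 y ;
  general_overlap_monor : forall x y1 y2 : U, y1 <= y2 -> GO x y1 <= GO x y2 ;
  general_overlap_continuous : continuous (fun p : U * U => GO p.1 p.2) }.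

Definition neutral_element GO (a : U) : Prop := forall x : U, GO x a = x.

Definition GON_implication GO N : U -> U -> U := fun x y => N (GO x (N y)).

Definition crisp I : Prop := forall x y : U, I x y = 0%:i01 \/ I x y = 1%:i01.

Definition NP I : Prop := forall y : U, I 1%:i01 y = y.
Definition IP I : Prop := forall x : U, I x x = 1%:i01.
Definition EP I : Prop := forall x y z : U, I x (I y z) = I y (I x z).
Definition IB I : Prop := forall x y : U, I x (I x y) = I x y.
Definition LOP I : Prop := forall x y : U, x <= y -> I x y = 1%:i01.
Definition ROP I : Prop := forall x y : U, x > y -> I x y <> 1%:i01.
Definition CP I N : Prop := forall x y : U, I x y = I (N y) (N x).
Definition RCP I N : Prop := forall x y : U, I x (N y) = I y (N x).

End fuzzy_operators.

(* Main.v *)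
Require Import Defs.
From mathcomp Require Import all_boot all_order all_algebra.
From mathcomp Require Import interval_inference.
From mathcomp Require Import all_classical all_reals topology normedtype.

(** Since [1] is neutral and [N 0 = 1], the implication restricts to [N] along
    [y = 0], so crispness of the implication makes [N] itself two-valued
    ([crisp_fuzzy_negation]).  Hence [GO] is only ever evaluated with second
    argument [0] or [1], where its values are forced, and the implication
    becomes Boolean material implication of the classes cut out by [N]: it
    equals [1] when [N y = 0] and [N x] when [N y = 1] ([GON_implication_false],
    [GON_implication_true]).  The exchange, iteration and contraposition laws
    are therefore those of classical logic, checked on truth tables; the only
    point where the order matters is the left ordering property, which uses that
    [N] is antitone.  The two negative claims come from a third point of the
    interval, here [1/2]: a two-valued function cannot fix it, and two of the
    points [0 < 1/2 < 1] lie in the same class of [N], where the implication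
    is [1] in both directions. *)

Local Open Scope ring_scope.

Import Order.TTheory GRing.Theory Num.Theory.

Section CrispImplication.
Context {R : realType}.
Local Notation U := {i01 R}.
Implicit Types (x y z : U).

Let half_ge0 : 0 <= 2^-1 :> R.
Proof. by rewrite invr_ge0 ler0n. Qed.

Let half_le1 : 2^-1 <= 1 :> R.
Proof. by rewrite invf_le1 ?ler1n ?ltr0n. Qed.

Let half : U := Itv01 half_ge0 half_le1.

Lemma i01_lt0half : 0%:i01 < half.
Proof. by rewrite -num_lt /= invr_gt0 ltr0n. Qed.

Lemma i01_lthalf1 : half < 1%:i01.
Proof. by rewrite -num_lt /= invf_lt1 ?ltr1n ?ltr0n. Qed.

Lemma i01_neq01 : (0%:i01 : U) <> 1%:i01.
Proof. by move=> /(congr1 (fun x : U => x%:num)) /eqP; rewrite eq_sym oner_eq0. Qed.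

Context (GO : U -> U -> U) (N : U -> U).
Hypotheses (hGO : general_overlap GO) (hGO1 : neutral_element GO 1%:i01).
Hypotheses (hN : fuzzy_negation N).
Local Notation I := (GON_implication GO N).

Lemma GON_implication_false x y : N y = 0%:i01 -> I x y = 1%:i01.
Proof.
move=> Ny; rewrite /GON_implication Ny (general_overlap0 hGO) ?mulr0 //.
exact: fuzzy_negation0.
Qed.

Lemma GON_implication_true x y : N y = 1%:i01 -> I x y = N x.
Proof. by move=> Ny; rewrite /GON_implication Ny hGO1. Qed.

Let N0 : N 0%:i01 = 1%:i01 := fuzzy_negation0 hN.
Let N1 : N 1%:i01 = 0%:i01 := fuzzy_negation1 hN.

Hypothesis hcrisp : crisp I.

(** Because [I x 0 = N x]. *)
Lemma crisp_fuzzy_negation x : N x = 0%:i01 \/ N x = 1%:i01.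
Proof.
by rewrite -(GON_implication_true x _ N0); exact: hcrisp.
Qed.

Lemma crisp_GON_implication_RCP : RCP I N.
Proof.
move=> x y; have [Nx|Nx] := crisp_fuzzy_negation x;
  have [Ny|Ny] := crisp_fuzzy_negation y; rewrite Nx Ny.
- by rewrite !GON_implication_true // Nx Ny.
- by rewrite GON_implication_false // GON_implication_true.
- by rewrite GON_implication_true // GON_implication_false.
- by rewrite !GON_implication_false.
Qed.

(** When [N z = 1] the inner implications are [N y] and [N x], so that exchange
    reduces to right contraposition. *)
Lemma crisp_GON_implication_EP : EP I.
Proof.
move=> x y z; have [Nz|Nz] := crisp_fuzzy_negation z.
  by rewrite !(GON_implication_false _ _ Nz) !GON_implication_false.
by rewrite !(GON_implication_true _ _ Nz) crisp_GON_implication_RCP.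
Qed.

Lemma crisp_GON_implication_not_NP : ~ NP I.
Proof.
move=> /(_ half) Ihalf; have := hcrisp 1%:i01 half.
by case=> /(etrans (esym Ihalf)) halfE;
  [have := i01_lt0half|have := i01_lthalf1]; rewrite halfE ltxx.
Qed.

(** The only way to fail is [N x = 0] and [N y = 1], which antitonicity of [N]
    excludes. *)
Lemma crisp_GON_implication_LOP : LOP I.
Proof.
move=> x y xy; have [Ny|Ny] := crisp_fuzzy_negation y.
  exact: GON_implication_false.
rewrite GON_implication_true //; have [Nx|//] := crisp_fuzzy_negation x.
have := fuzzy_negation_antitone hN xy; rewrite Nx Ny -num_le /=.
by rewrite ler10.
Qed.

(** Whichever class of [N] contains [1/2], it also contains an endpoint. *)
Lemma crisp_GON_implication_not_ROP : ~ ROP I.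
Proof.
move=> rop; have [Nh|Nh] := crisp_fuzzy_negation half.
  by apply: (rop _ _ i01_lthalf1); exact: GON_implication_false.
by apply: (rop _ _ i01_lt0half); rewrite GON_implication_true.
Qed.

Lemma crisp_GON_implication_IB : IB I.
Proof.
move=> x y; have [Iy|Iy] := hcrisp x y; rewrite Iy.
  (* [I x 0 = N x], and [I x y = 0] forces [N y = 1], hence [N x = I x y] *)
  rewrite GON_implication_true //.
  have [Ny|Ny] := crisp_fuzzy_negation y.
    by case: i01_neq01; rewrite -Iy GON_implication_false.
  by rewrite -Iy GON_implication_true.
exact: GON_implication_false.
Qed.

Lemma crisp_GON_implication_CP : CP I N.
Proof.
move=> x y; have [Nx|Nx] := crisp_fuzzy_negation x;
  have [Ny|Ny] := crisp_fuzzy_negation y; rewrite Nx Ny.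
- by rewrite GON_implication_false // GON_implication_true.
- by rewrite !GON_implication_true // N1.
- by rewrite !GON_implication_false.
- by rewrite GON_implication_true // GON_implication_false.
Qed.

End CrispImplication.

Theorem proposition17 (R : realType) (GO : {i01 R} -> {i01 R} -> {i01 R})
    (N : {i01 R} -> {i01 R}) (hGO : general_overlap GO)
    (hGO1 : neutral_element GO 1%:i01) (hN : fuzzy_negation N)
    (hcrisp : crisp (GON_implication GO N)) :
  (EP (GON_implication GO N) /\ ~ NP (GON_implication GO N)) /\
  (LOP (GON_implication GO N) /\ ~ ROP (GON_implication GO N)) /\
  IP (GON_implication GO N) /\
  IB (GON_implication GO N) /\
  CP (GON_implication GO N) N /\
  RCP (GON_implication GO N) N.
Proof.
have LOPI := crisp_GON_implication_LOP _ _ hGO hGO1 hN hcrisp.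
split; first split.
- exact: crisp_GON_implication_EP.
- exact: crisp_GON_implication_not_NP.
split; first split.
- exact: LOPI.
- exact: crisp_GON_implication_not_ROP.
split; first by move=> x; exact: LOPI.
split; first exact: crisp_GON_implication_IB.
split; first exact: crisp_GON_implication_CP.
exact: crisp_GON_implication_RCP.
Qed.
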